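(* Let $X$ be a Banach space of type $p>1$ with type $p$ constant $T_p(X)$, and let $D\subset X$ be a normalized set. (1) If $D$ is a $c$-ARS in $X$ for some $c>1$, then $D$ is a $(c_1,q)$-quick representing system in $X$, for some $c_1>0$ and $q\in(0,1)$ depending only on $c$, $p$ and $T_p(X)$. (2) Conversely, if $D$ is a $(c_1,q)$-quick representing system in $X$ for some $c_1>0$ and $q\in(0,1)$, then $D$ is a $c$-ARS in $X$ for some $c$ depending only on $c_1$ and $q$.
   Context: Banach spaces are real and nonzero; $B(X)$ is the closed unit ball of $X$. A set is normalized if all its elements have norm $1$. A set $D\subset X$ is a $c$-ARS ($c$-absolutely representing system) in $X$ if every $x\in B(X)$ can be written as $x=\sum_{i=1}^\infty a_i x_i$ with scalars $a_i$, elements $x_i\in D$ (repetitions allowed), and $\sum_{i=1}^\infty\|a_i x_i\|\le c$. For $c>0$ and $q\in(0,1)$, a set $D\subset X$ is a $(c,q)$-quick representing system in $X$ if every $x\in X$ can be written as $x=\sum_{i=1}^\infty a_i x_i$ with scalars $a_i$, elements $x_i\in D$ (repetitions allowed), and $\|a_i x_i\|\le c q^{i-1}\|x\|$ for all $i\ge1$. $X$ is of type $p$ if there is $C>0$ such that $\mathbf{E}\big\|\sum_{i\le n}\epsilon_i x_i\big\|^p\le C^p\sum_{i\le n}\|x_i\|^p$ for all $n\ge 1$ and all $x_1,\dots,x_n\in X$, where $\epsilon_i$ are independent random variables with $\mathbf{P}\{\epsilon_i=1\}=\mathbf{P}\{\epsilon_i=-1\}=1/2$; $T_p(X)$ denotes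 the least such $C$. *)

(* Defs.v *)
From HB Require Import structures.
From mathcomp Require Import all_boot all_order all_algebra.
From mathcomp Require Import all_classical all_reals all_analysis.

Set Implicit Arguments.
Unset Strict Implicit.
Unset Printing Implicit Defensive.

Import Order.TTheory GRing.Theory Num.Theory.
Import numFieldNormedType.Exports.

Local Open Scope classical_set_scope.
Local Open Scope ring_scope.

Section representing_systems.
Context {R : realType} {X : completeNormedModType R}.

Definition normalized (D : set X) : Prop := forall x, D x -> `|x| = 1.

(* In the next two definitions series are indexed from 0, so that the i-th
   term is the (i+1)-st term of the usual 1-indexed series. *)
Definition abs_representing_system (c : R) (D : set X) : Prop :=
  forall x : X, `|x| <= 1 ->
  exists (a : nat -> R) (y : nat -> X),
    [/\ forall i, D (y i),
        series (fun i => a i *: y i) @ \oo --> x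
      & (\sum_(0 <= i <oo) `|a i *: y i|%:E <= c%:E)%E].

Definition quick_representing_system (c q : R) (D : set X) : Prop :=
  forall x : X,
  exists (a : nat -> R) (y : nat -> X),
    [/\ forall i, D (y i),
        series (fun i => a i *: y i) @ \oo --> x
      & forall i, `|a i *: y i| <= c * q ^+ i * `|x|].

End representing_systems.

Section rademacher.
Context {R : realType} {d : measure_display} {Omega : measurableType d}.
Context {P : probability Omega R} {n : nat}.

Definition mutually_independent (eps : 'I_n -> {RV P >-> R}) : Prop :=
  forall (J : {set 'I_n}) (A : 'I_n -> set R),
    (forall i, measurable (A i)) ->
    P (\bigcap_(i in [set` J]) (eps i @^-1` A i)) =
    (\prod_(i in J) P (eps i @^-1` A i))%E.

Definition rademacher_family (eps : 'I_n -> {RV P >-> R}) : Prop :=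
  mutually_independent eps /\
  forall i, P [set w | eps i w = 1] = (2^-1)%:E /\
            P [set w | eps i w = -1] = (2^-1)%:E.

End rademacher.

Section type_p.
Context {R : realType}.
Variables (p : R) (X : completeNormedModType R).

(* The expectation depends only on the joint law of the signs, so quantifying
   over all probability spaces carrying a Rademacher family is the same as
   fixing one of them. *)
Definition type_inequality (C : R) : Prop :=
  forall (n : nat) (x : 'I_n -> X), (1 <= n)%N ->
  forall (d : measure_display) (Omega : measurableType d)
         (P : probability Omega R) (eps : 'I_n -> {RV P >-> R}),
    rademacher_family eps ->
    ('E_P[fun w => (`|\sum_(i < n) eps i w *: x i| `^ p)%R]
       <= (C `^ p * \sum_(i < n) `|x i| `^ p)%R%:E)%E.

Definition of_type : Prop := exists C : R, 0 < C /\ type_inequality C.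

Definition is_type_constant (T : R) : Prop :=
  [/\ 0 < T, type_inequality T
    & forall C : R, 0 < C -> type_inequality C -> T <= C].

End type_p.

Lemma type_inequality_ge1 (R : realType) (p : R) (X : completeNormedModType R) C :
  0 < p -> (exists x : X, x != 0) -> 0 < C -> type_inequality p X C -> 1 <= C.
Proof.
move=> p0 [x x0] C0 H.
have h01 : 0 <= (2^-1 : R) <= 1 by rewrite invr_ge0 ler0n invf_le1 ?ltr0n// ler1n.
pose P : probability bool R := bernoulli_prob 2^-1.
pose f (b : bool) : R := if b then 1 else -1.
have mf : measurable_fun setT f by [].
pose e : {RV P >-> R} := mfun_Sub (mem_set mf : f \in mfun).
have h2 : unstable.onem (2^-1 : R) = 2^-1 by rewrite /unstable.onem {1}(splitr 1) mul1r addrK.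
have Hr : rademacher_family (fun _ : 'I_1 => e).
  split.
    move=> J A mA.
    have [->|->] : J = finset.set0 \/ J = finset.setTfor 'I_1.
      case: (boolP (ord0 \in J)) => h; [right|left]; apply/finset.setP => i; rewrite ord1 !inE ?h//.
      exact: negbTE.
    - rewrite (_ : \bigcap_(_ in _) _ = setT); last first.
        by apply/seteqP; split => // w _ i /=; rewrite inE.
      by rewrite probability_setT finset.big_set0.
    - rewrite (_ : \bigcap_(_ in _) _ = e @^-1` A ord0); last first.
        apply/seteqP; split => [w|w Aw i _]; first by apply; rewrite /= inE.
        by rewrite ord1.
      rewrite (eq_bigl xpredT); last by move=> i; rewrite inE.
      by rewrite big_ord_recl big_ord0 mule1.
  move=> _; rewrite /P /= !bernoulli_probE// !diracE h2; split.
    rewrite mem_set// memNset ?mule1 ?mule0 ?adde0//=.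
    by apply/eqP; rewrite /f eq_sym -subr_eq0 opprK (_ : 1 + 1 = 2)// pnatr_eq0.
  rewrite memNset ?mem_set ?mule1 ?mule0 ?add0e//=.
  by apply/eqP; rewrite /f -subr_eq0 opprK (_ : 1 + 1 = 2)// pnatr_eq0.
have /= := H 1%N (fun _ => x) isT _ _ P _ Hr.
rewrite unlock integral_bernoulli_prob//=.
rewrite h2 !big_ord_recl !big_ord0 /= !addr0 scale1r scaleN1r normrN.
rewrite -!EFinM -EFinD lee_fin -mulrDl.
rewrite (_ : 2^-1 + 2^-1 = 1); last by rewrite [RHS](splitr 1) mul1r.
rewrite mul1r -{1}[_ `^ p]mul1r.
rewrite ler_pM2r ?powR_gt0 ?normr_gt0// => h.
rewrite leNgt; apply/negP => C1.
have := gt0_ltr_powR p0 (ltW C0) ler01 C1.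
by rewrite powR1 ltNge h.
Qed.

(* A space of type p has a least type p constant, so the hypothesis
   is_type_constant p X T merely names it. *)
Lemma type_constant_exists (R : realType) (p : R) (X : completeNormedModType R) :
  0 < p -> (exists x : X, x != 0) -> of_type p X -> exists T, is_type_constant p X T.
Proof.
move=> p0 X0 [C [C0 HC]].
pose S := [set C | 0 < C /\ type_inequality p X C].
have S1 : lbound S 1 by move=> c [c0 hc]; apply: type_inequality_ge1 hc.
have SC : S C by [].
have iS1 : 1 <= inf S by apply: lb_le_inf => //; exists C.
exists (inf S); split.
- exact: lt_le_trans iS1.
- move=> n x n0 d Om P eps he.
  set E := ('E_P[_])%E; set s := \sum_(i < n) _.
  have s0 : 0 <= s by apply: sumr_ge0 => i _; exact: powR_ge0.
  have ES c : S c -> (E <= (c `^ p * s)%:E)%E by move=> [_ hc]; exact: hc.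
  have E0 : (0 <= E)%E by rewrite /E unlock; apply: integral_ge0 => w _; rewrite lee_fin powR_ge0.
  have Ef : E \is a fin_num by rewrite ge0_fin_numE//; apply: le_lt_trans (ES _ SC) (ltry _).
  move: ES E0; rewrite -(fineK Ef) => ES; rewrite !lee_fin => E0.
  move: s0; rewrite le_eqVlt => /orP[/eqP s0|s0].
    by have := ES _ SC; rewrite -s0 !mulr0.
  rewrite -ler_pdivrMr//.
  have q0 : 0 <= fine E / s by rewrite divr_ge0// ltW.
  have : (fine E / s) `^ p^-1 <= inf S.
    apply: lb_le_inf; first by exists C.
    move=> c Sc; have := ES _ Sc; rewrite lee_fin -ler_pdivrMr// => h.
    have c0 := ltW Sc.1.
    have := ge0_ler_powR (r := p^-1) _ _ _ h; rewrite -powRrM mulfV ?gt_eqF// powRr1//.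
    by apply; rewrite ?nnegrE ?invr_ge0 ?powR_ge0// ltW.
  move=> h; have := ge0_ler_powR (ltW p0) _ _ h.
  rewrite -powRrM mulVf ?gt_eqF// powRr1//; apply; rewrite nnegrE ?powR_ge0//.
  exact: le_trans iS1.
- move=> c c0 hc; apply: ge_inf => //; by exists 1.
Qed.

(* Main.v *)
(* For the first part, Maurey's empirical method is replaced by repeated
   halving.  In a space of type p some choice of signs makes the signed sum of
   n unit vectors at most T n^(1/p), so the sum of the n vectors is within that
   distance of twice the sum of at most n / 2 of them.  As p > 1, the errors of
   successive halvings form a geometric series, and a long sum of M vectors,
   weighted c / M, is reduced to N terms weighted c / N with an error of order
   N^(1/p - 1), where N depends only on c, p and T.  Applied to a representation
   with absolute sum c, after rounding its coefficients, this approximates every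
   x within |x| / 2 by N terms of size at most c |x|; iterating on the remainders
   gives a quick representation with q = 2^(-1/N).  The converse is the sum of a
   geometric series. *)
Require Import Defs.
From HB Require Import structures.
From mathcomp Require Import all_boot all_order all_algebra.
From mathcomp Require Import zify ring lra.
From mathcomp Require Import all_classical all_reals all_analysis.
Import Order.TTheory GRing.Theory Num.Theory.
Import numFieldNormedType.Exports.
Local Open Scope classical_set_scope.
Local Open Scope ring_scope.

(** * A concrete Rademacher family *)

Section canonical_rademacher_family.
Context {R : realType} (n : nat).

(* The points of nat below 2 ^ n stand for the sign vectors in
   {ffun 'I_n -> bool}, through their enumeration. *)
Definition sign_prob : set nat -> \bar R :=
  mscale (2^-1 ^+ n)%:nng (msum (fun k => \d_k) #|{ffun 'I_n -> bool}|).

HB.instance Definition _ := Measure.on sign_prob.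

Lemma sign_probE (A : set nat) :
  sign_prob A = (2^-1 ^+ n *
    \sum_(f : {ffun 'I_n -> bool}) ((enum_rank f : nat) \in A)%:R)%:E.
Proof.
rewrite /sign_prob /mscale /= /msum EFinM; congr (_ * _)%E.
rewrite (eq_bigr (fun k : 'I_ _ => (((k : nat) \in A)%:R)%:E)); last first.
  by move=> k _; exact: diracE.
rewrite sumEFin; congr EFin.
by rewrite (reindex (@enum_rank {ffun 'I_n -> bool}))//; exact/onW_bij/enum_rank_bij.
Qed.

Lemma sign_prob_setT : sign_prob setT = 1%E.
Proof.
rewrite sign_probE (eq_bigr (fun=> 1)); last by move=> f _; rewrite in_setT.
rewrite sumr_const card_ffun card_bool card_ord natrX -exprMn mulVf ?pnatr_eq0//.
by rewrite expr1n.
Qed.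

HB.instance Definition _ :=
  Measure_isProbability.Build _ _ _ sign_prob sign_prob_setT.

(** The default vector of [nth] is reached only for [k] at least 2^n, where [sign_prob] has no
    mass. *)
Definition sign_coord (i : 'I_n) (k : nat) : R :=
  (-1) ^+ nth [ffun=> false] (enum {ffun 'I_n -> bool}) k i.

Lemma sign_coord_measurable i : measurable_fun setT (sign_coord i).
Proof. by []. Qed.

Definition sign_rv (i : 'I_n) : {RV sign_prob >-> R} :=
  mfun_Sub (mem_set (sign_coord_measurable i) : sign_coord i \in mfun).

Lemma sign_coord_enum_rank i (f : {ffun 'I_n -> bool}) :
  sign_coord i (enum_rank f) = (-1) ^+ f i.
Proof. by rewrite /sign_coord nth_enum_rank. Qed.

(** The law of a single fair sign. *)
Definition sign_mass (A : set R) : R := ((1 \in A)%:R + (-1 \in A)%:R) / 2.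

(** The indicator of the event is a product of one factor per coordinate, so its sum over all sign
    vectors factors by distributivity. Independence and the marginal laws both follow. *)
Lemma sign_prob_bigcap (J : {set 'I_n}) (A : 'I_n -> set R) :
  sign_prob (\bigcap_(i in [set` J]) (sign_rv i @^-1` A i)) =
  (\prod_(i in J) sign_mass (A i))%:E.
Proof.
rewrite sign_probE; congr EFin.
pose G i (b : bool) : R := if i \in J then ((-1) ^+ b \in A i)%:R else 1.
rewrite (eq_bigr (fun f : {ffun 'I_n -> bool} => \prod_i G i (f i))); last first.
  move=> f _; rewrite -big_mkcond/=.
  have [/forallP fJ|] := boolP [forall i, (i \in J) ==> ((-1) ^+ f i \in A i)].
    rewrite big1 => [|i iJ]; last by have /implyP -> := fJ i.
    rewrite mem_set// => i /= iJ; rewrite sign_coord_enum_rank.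
    by have /implyP/(_ iJ)/set_mem := fJ i.
  rewrite negb_forall => /existsP[i]; rewrite negb_imply => /andP[iJ iA].
  rewrite (bigD1 i)//= (negbTE iA) mul0r memNset// => /(_ i iJ)/=.
  by rewrite sign_coord_enum_rank => /mem_set; apply/negP.
rewrite -bigA_distr_bigA/= -[X in 2^-1 ^+ X]card_ord -prodr_const -big_split/=.
rewrite [RHS]big_mkcond/=; apply: eq_bigr => i _.
rewrite big_bool /G /= expr1 expr0; case: ifP => _; last by rewrite mulVf.
by rewrite mulrC addrC.
Qed.

Lemma sign_prob_preimage i (A : set R) :
  sign_prob (sign_rv i @^-1` A) = (sign_mass A)%:E.
Proof.
rewrite -[sign_mass A](big_set1 *%R i (fun=> sign_mass A)).
rewrite -(sign_prob_bigcap _ (fun=> A)); congr sign_prob.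
apply/seteqP; split => [w Aw j|w /(_ i)]; first by rewrite /= inE => /eqP ->.
by apply; rewrite /= inE.
Qed.

Lemma sign_rv_rademacher : rademacher_family sign_rv.
Proof.
split=> [J A _|i].
  rewrite [LHS]sign_prob_bigcap -prodEFin.
  by apply: eq_bigr => i _; rewrite [RHS]sign_prob_preimage.
have n1 : (1 == -1 :> R) = false by rewrite -subr_eq0 opprK (_ : 1 + 1 = 2)// pnatr_eq0.
split.
  rewrite [LHS](sign_prob_preimage i [set 1]) /sign_mass !in_set1.
  by rewrite eqxx eq_sym n1 addr0 mul1r.
rewrite [LHS](sign_prob_preimage i [set -1]) /sign_mass !in_set1.
by rewrite eqxx n1 add0r mul1r.
Qed.

End canonical_rademacher_family.

(** A minimum is at most the mean: take signs minimizing the norm of the signed sum. *)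
Lemma type_inequality_signs {R : realType} (p T : R) (X : completeNormedModType R)
    (n : nat) (x : 'I_n -> X) :
  0 < p -> 0 <= T -> type_inequality p X T -> (1 <= n)%N ->
  exists e : 'I_n -> bool,
    `|\sum_(i < n) (-1) ^+ e i *: x i| <= T * (\sum_(i < n) `|x i| `^ p) `^ p^-1.
Proof.
move=> p0 T0 XT n0.
pose F := {ffun 'I_n -> bool}.
pose g (f : F) := `|\sum_(i < n) (-1) ^+ f i *: x i| `^ p.
pose f0 : F := [ffun=> false].
pose f := [arg min_(f < f0) g f]%O.
have fP h : g f <= g h by rewrite /f; case: arg_minP => // h' _; exact.
exists f.
have : ((g f)%:E <= (T `^ p * \sum_(i < n) `|x i| `^ p)%:E)%E.
  apply: le_trans (XT n x n0 _ _ _ _ (sign_rv_rademacher n)).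
  rewrite -(expectation_cst (sign_prob n)); apply: expectation_le => //.
    by move=> k; exact: powR_ge0.
  (* Past the enumeration [nth] returns [f0], still a sign vector, so the bound holds at every
     point. *)
  by apply: aeW => k; exact: (fP (nth f0 (enum F) k)).
have s0 : 0 <= \sum_(i < n) `|x i| `^ p by apply: sumr_ge0 => i _; exact: powR_ge0.
rewrite lee_fin => /(ge0_ler_powR (r := p^-1)).
rewrite powRM ?powR_ge0// -!powRrM mulfV ?gt_eqF// !powRr1//.
by apply; rewrite ?nnegrE ?mulr_ge0 ?invr_ge0 ?powR_ge0// ltW.
Qed.

(** * Shortening sums by repeated halving *)

Section thinning.
Context {R : realType} {X : completeNormedModType R}.
Variables (p T : R).
Hypotheses (p1 : 1 < p) (T0 : 0 <= T) (XT : type_inequality p X T).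

Let p0 : 0 < p. Proof. exact: lt_trans p1. Qed.

(* Signs making the signed sum small split s into two sublists whose sums are
   close to each other, hence to half of the sum of s; keep the shorter one. *)
Lemma halve_sum (s : seq X) :
  {in s, forall y, `|y| <= 1} ->
  exists s' : seq X, [/\ {subset s' <= s}, (2 * size s' <= size s)%N
    & `|\sum_(y <- s) y - 2 *: \sum_(y <- s') y| <= T * (size s)%:R `^ p^-1].
Proof.
move=> s1; have [/size0nil ->|n0] := posnP (size s).
  by exists [::]; split => //; rewrite !big_nil scaler0 subr0 normr0 mulr_ge0 ?powR_ge0.
pose x i := tnth (in_tuple s) i.
have [e he] := type_inequality_signs _ _ _ _ x p0 T0 XT n0.
have [b hb] : exists b, (2 * #|[pred i | e i == b]| <= size s)%N.
  have kl : #|[pred i | e i == true]| + #|[pred i | e i == false]| = size s.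
    rewrite -[RHS]card_ord -[RHS](cardC [pred i | e i == true]); congr addn.
    by apply: eq_card => i; rewrite !inE; case: (e i).
  have [lk|lk] := leqP #|[pred i | e i == true]| #|[pred i | e i == false]|.
    by exists true; lia.
  by exists false; lia.
exists [seq x i | i <- enum [pred i | e i == b]]; split.
- by move=> _ /mapP[i _ ->]; exact: mem_tnth.
- by rewrite size_map -cardE.
rewrite big_map big_enum/= [X in `|X - _|](big_tnth _ _ s)/=.
(* Subtracting twice the vectors of sign class [b] flips exactly their signs, which gives the signed
   sum up to a global sign. *)
have -> : \sum_i x i - 2 *: \sum_(i in [pred i | e i == b]) x i =
    ((-1) ^+ (~~ b) : R) *: \sum_(i < size s) ((-1) ^+ e i : R) *: x i.
  rewrite [\sum_(i in _) _]big_mkcond/= !scaler_sumr -sumrB; apply: eq_bigr => i _.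
  rewrite inE scalerA -signr_addb scaler_sign.
  by case: (e i) b {hb} => -[] //=; rewrite ?scaler0 ?subr0// scaler_nat mulr2n opprD addrA subrr sub0r.
rewrite normrZ normr_sign mul1r (le_trans he)// ler_wpM2l//.
have pi0 : 0 <= p^-1 by rewrite invr_ge0 ltW.
apply: ge0_ler_powR => //; rewrite ?nnegrE ?ler0n//.
  by apply: sumr_ge0 => i _; exact: powR_ge0.
rewrite -[X in X%:R]card_ord -sumr_const; apply: ler_sum => i _.
apply: (@le_trans _ _ (1 `^ p)); last by rewrite powR1.
apply: ge0_ler_powR; rewrite ?nnegrE ?(ltW p0)//.
by rewrite s1// mem_tnth.
Qed.

(** The quotient 2^(1 - 1/p) of the two sides exceeds 1 because its exponent is positive. *)
Lemma root2_lt2 : 2 `^ p^-1 < 2 :> R.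
Proof.
have th0 : 0 < 1 - p^-1 by rewrite subr_gt0 invf_lt1.
have : 1 `^ (1 - p^-1) < 2 `^ (1 - p^-1) :> R.
  by apply: gt0_ltr_powR; rewrite ?nnegrE ?ltr1n.
rewrite powR1 -(ltr_pM2l (powR_gt0 p^-1 (ltr0n R 2))) mulr1 -powRD ?pnatr_eq0 ?implybT//.
by rewrite addrC subrK powRr1.
Qed.

(** Halving number l, counted from 0, acts on at most 2^(L-l) N vectors of weight 2^l, so it costs
    at most T N^(1/p) 2^l rho^(L-l). Summing over l < L gives the bound, with the denominator
    [2 - rho] cleared. *)
Lemma thin_sum (N L : nat) (s : seq X) (rho := 2 `^ p^-1) :
  {in s, forall y, `|y| <= 1} -> (size s <= 2 ^ L * N)%N ->
  exists s' : seq X, [/\ {subset s' <= s}, (size s' <= N)%N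
    & (2 - rho) * `|\sum_(y <- s) y - 2 ^+ L *: \sum_(y <- s') y|
      <= T * rho * N%:R `^ p^-1 * (2 ^+ L - rho ^+ L)].
Proof.
have pi0 : 0 <= p^-1 by rewrite invr_ge0 ltW.
elim: L s => [|L IH] s s1 sN.
  exists s; split => //; first by rewrite mul1n in sN.
  by rewrite !expr0 scale1r !subrr normr0 !mulr0.
have [s2 [s2s sz2 h2]] := halve_sum _ s1.
have [| |s3 [s3s sz3 h3]] := IH s2; first by move=> y /s2s /s1.
  by move: sN; rewrite expnS; lia.
exists s3; split => //; first by move=> y /s3s /s2s.
have {}h2 : `|\sum_(y <- s) y - 2 *: \sum_(y <- s2) y| <= T * (rho ^+ L.+1 * N%:R `^ p^-1).
  apply: (le_trans h2); rewrite ler_wpM2l//.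
  have -> : rho ^+ L.+1 * N%:R `^ p^-1 = (2 ^ L.+1 * N)%:R `^ p^-1.
    rewrite natrM powRM ?ler0n// natrX; congr (_ * _).
    by rewrite /rho -!powR_mulrn ?powR_ge0// -!powRrM mulrC.
  by apply: ge0_ler_powR; rewrite ?nnegrE ?ler_nat.
set S1 := \sum_(y <- s) y in h2 *; set S2 := \sum_(y <- s2) y in h2 h3 *.
set S3 := \sum_(y <- s3) y in h3 *.
have rho2 : 0 < 2 - rho by rewrite subr_gt0 root2_lt2.
have -> : S1 - 2 ^+ L.+1 *: S3 = (S1 - 2 *: S2) + 2 *: (S2 - 2 ^+ L *: S3).
  by rewrite scalerBr scalerA -exprS addrA subrK.
apply: (@le_trans _ _ ((2 - rho) * (T * (rho ^+ L.+1 * N%:R `^ p^-1) +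
    2 * `|S2 - 2 ^+ L *: S3|))).
  rewrite ler_wpM2l ?(ltW rho2)// (le_trans (ler_normD _ _))// lerD//.
  by rewrite normrZ ger0_norm.
rewrite mulrDr [(2 - rho) * (2 * _)]mulrCA.
apply: (@le_trans _ _ ((2 - rho) * (T * (rho ^+ L.+1 * N%:R `^ p^-1)) +
   2 * (T * rho * N%:R `^ p^-1 * (2 ^+ L - rho ^+ L)))).
  by rewrite lerD2l ler_wpM2l.
by rewrite le_eqVlt; apply/orP; left; apply/eqP; rewrite !exprS; ring.
Qed.
End thinning.

(** After division by N^(1/p) this asks for K <= N^(1 - 1/p), true of any integer above K^(1/(1 -
    1/p)). *)
Lemma exists_natr_powR_le {R : realType} (p K : R) : 1 < p -> 0 <= K ->
  exists N : nat, (0 < N)%N /\ K * N%:R `^ p^-1 <= N%:R.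
Proof.
move=> p1 K0.
have p0 : 0 < p by exact: lt_trans p1.
have th0 : 0 < 1 - p^-1 by rewrite subr_gt0 invf_lt1.
pose M := K `^ (1 - p^-1)^-1.
exists (Num.truncn M).+1; split=> //; set N := _.+1.
have KN : K <= N%:R `^ (1 - p^-1).
  have -> : K = M `^ (1 - p^-1) by rewrite /M -powRrM mulVf ?gt_eqF// powRr1.
  apply: ge0_ler_powR; rewrite ?nnegrE ?powR_ge0 ?(ltW th0)//.
  by have /andP[_ /ltW] := truncn_itv (powR_ge0 K (1 - p^-1)^-1).
apply: le_trans (ler_wpM2r (powR_ge0 _ _) KN) _.
by rewrite -powRD ?pnatr_eq0 ?implybT// subrK powRr1.
Qed.

(** * Approximating the unit ball by short sums with equal weights *)

Section approximation.
Context {R : realType} {X : completeNormedModType R}.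
Variable D : set X.

(** Round each [|a i|] down to a multiple k h, move the sign of [a i] onto [y i], and list that
    vector k times. Each term loses at most [h]. *)
Lemma discretize_sum (a : nat -> R) (y : nat -> X) (h : R) (m : nat) :
  normalized D -> (forall i, D (y i)) -> 0 < h ->
  exists s : seq X, [/\ {in s, forall z, D z \/ D (- z)},
    h * (size s)%:R <= \sum_(0 <= i < m) `|a i *: y i|
    & `|\sum_(0 <= i < m) a i *: y i - h *: \sum_(z <- s) z| <= m%:R * h].
Proof.
move=> D1 Dy h0; elim: m => [|m [s [sD hs sm]]].
  by exists [::]; rewrite !big_geq// big_nil scaler0 subr0 normr0 mulr0 mul0r.
pose k := Num.truncn (`|a m| / h).
have /andP[ka ak] := truncn_itv (divr_ge0 (normr_ge0 (a m)) (ltW h0)).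
rewrite ler_pdivlMr// in ka; rewrite ltr_pdivrMr// -/k in ak; rewrite -/k in ka.
pose z := (-1) ^+ (a m < 0)%R *: y m.
exists (nseq k z ++ s); split.
- move=> u; rewrite mem_cat mem_nseq => /orP[/andP[_ /eqP ->]|/sD//].
  rewrite /z; case: (a m < 0).
    by right; rewrite expr1 scaleN1r opprK.
  by left; rewrite expr0 scale1r.
- rewrite size_cat size_nseq natrD mulrDr addrC big_nat_recr//= lerD//.
  by rewrite normrZ (D1 _ (Dy m)) mulr1 mulrC.
rewrite big_nat_recr//= big_cat big_nseq iter_addr_0 -scaler_nat/=.
have -> : a m *: y m = `|a m| *: z.
  by rewrite /z scalerA mulrC -realEsign ?num_real.
have z1 : `|z| = 1 by rewrite normrZ normr_sign (D1 _ (Dy m)) mulr1.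
clearbody z.
rewrite scalerDr scalerA [\sum_(0 <= i < m) _ + _]addrC opprD addrACA -scalerBl -natr1 mulrDl mul1r.
rewrite [leRHS]addrC (le_trans (ler_normD _ _))// lerD//.
rewrite normrZ z1 mulr1 ger0_norm.
  by move: ak; rewrite -natr1; lra.
by rewrite subr_ge0 mulrC.
Qed.

(** The error 1/2 is 1/8 for truncating the series, 1/8 for rounding the coefficients and 1/4 for
    thinning. *)
Lemma ars_approximation (c p T : R) (N : nat) :
  normalized D -> 0 < c -> 1 < p -> 0 < T -> type_inequality p X T ->
  abs_representing_system c D -> (0 < N)%N ->
  4 * (c * T * 2 `^ p^-1 / (2 - 2 `^ p^-1)) * N%:R `^ p^-1 <= N%:R ->
  forall x : X, `|x| <= 1 ->
  exists s : seq X, [/\ {in s, forall z, D z \/ D (- z)}, (size s <= N)%N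
    & `|x - (c / N%:R) *: \sum_(z <- s) z| <= 2^-1].
Proof.
move=> D1 c0 p1 T0 XT arsD N0 hN x x1.
have [a [y [Dy ax ac]]] := arsD x x1.
have [m hm] : exists m, `|x - \sum_(0 <= i < m) a i *: y i| <= 8^-1.
  have /cvgrPdist_le/(_ 8^-1) [|m _ hm] := ax; first by rewrite invr_gt0.
  by exists m; have := hm m (leqnn m).
have am : \sum_(0 <= i < m) `|a i *: y i| <= c.
  rewrite -lee_fin -sumEFin (le_trans _ ac)//.
  by apply: nneseries_lim_ge => i _ _; rewrite lee_fin.
(* [L] makes the rounding error [m * h] at most 1/8. With the [h] below, the rounded list has at
   most c / h = 2^L N entries, and [L] halvings raise the weight [h] to exactly c / N. *)
pose L := Num.bound (8 * m%:R * c / N%:R).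
have N0' : 0 < N%:R :> R by rewrite ltr0n.
pose h := c / N%:R / 2 ^+ L.
have h0 : 0 < h by rewrite !divr_gt0// exprn_gt0.
have hL : h * 2 ^+ L = c / N%:R by rewrite /h divfK// gt_eqF// exprn_gt0.
have mh : m%:R * h <= 8^-1.
  have : 8 * m%:R * c / N%:R <= 2 ^+ L by apply/ltW/upper_nthrootP.
  rewrite -[_ * c / _]mulrA -hL mulrA -[leRHS]mul1r ler_pM2r ?exprn_gt0//.
  by rewrite -mulrA; lra.
have [s [sD hs hsum]] := discretize_sum a y h m D1 Dy h0.
have s1 : {in s, forall z, `|z| <= 1}.
  by move=> z /sD[/D1 ->//|/D1]; rewrite normrN => ->.
have sz : (size s <= 2 ^ L * N)%N.
  rewrite -(ler_nat R) natrM natrX -(ler_pM2l h0) mulrA hL divfK ?gt_eqF//.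
  exact: le_trans am.
have [s' [s's sN hs']] := thin_sum p T p1 (ltW T0) XT N L s s1 sz.
exists s'; split => //; first by move=> z /s's /sD.
set rho := 2 `^ p^-1 in hN hs'.
have rho2 : 0 < 2 - rho by rewrite subr_gt0 root2_lt2.
have h4 : `|h *: \sum_(z <- s) z - (c / N%:R) *: \sum_(z <- s') z| <= 4^-1.
  rewrite -hL -scalerA -scalerBr normrZ (gtr0_norm h0).
  rewrite -(ler_pM2l rho2) mulrCA.
  apply: (@le_trans _ _ (h * (T * rho * N%:R `^ p^-1 * 2 ^+ L))).
    rewrite ler_pM2l// (le_trans hs')// ler_wpM2l ?mulr_ge0 ?powR_ge0 ?(ltW T0)//.
    by rewrite gerBl exprn_ge0// powR_ge0.
  rewrite [X in h * X]mulrC mulrA hL.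
  have {}hN : 4 * (c * (T * rho * N%:R `^ p^-1)) <= N%:R * (2 - rho).
    rewrite -ler_pdivrMr// (le_trans _ hN)// le_eqVlt; apply/orP; left; apply/eqP; ring.
  rewrite mulrAC ler_pdivrMr//; lra.
have -> : x - (c / N%:R) *: \sum_(z <- s') z =
    (x - \sum_(0 <= i < m) a i *: y i) +
    (\sum_(0 <= i < m) a i *: y i - h *: \sum_(z <- s) z) +
    (h *: \sum_(z <- s) z - (c / N%:R) *: \sum_(z <- s') z).
  by rewrite !addrA !subrK.
have := ler_normD (x - \sum_(0 <= i < m) a i *: y i)
    (\sum_(0 <= i < m) a i *: y i - h *: \sum_(z <- s) z).
move: h4; set u := h *: _ - _ *: _; set v := _ + _ => h4 hv.
by have := ler_normD v u; move: hm hsum; lra.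
Qed.
End approximation.

(** * From approximation within half the norm to quick representation *)

Section iteration.
Context {R : realType} {X : completeNormedModType R}.
Variable D : set X.

(* The k-th block of N terms approximates the remainder left by the first k blocks. *)
Lemma quick_of_half_approximation (N : nat) (K q : R) :
  (0 < N)%N -> 0 <= K -> 0 < q < 1 -> q ^+ N = 2^-1 ->
  (forall x : X, exists (b : nat -> R) (y : nat -> X),
    [/\ forall j, D (y j), forall j, `|b j *: y j| <= K * `|x|
      & `|x - \sum_(0 <= j < N) b j *: y j| <= `|x| / 2]) ->
  quick_representing_system (2 * K) q D.
Proof.
move=> N0 K0 /andP[q0 q1] qN approx x.
have /choice[g gP] : forall z, exists u : (nat -> R) * (nat -> X),
    [/\ forall j, D (u.2 j), forall j, `|u.1 j *: u.2 j| <= K * `|z|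
      & `|z - \sum_(0 <= j < N) u.1 j *: u.2 j| <= `|z| / 2].
  by move=> z; have [b [y h]] := approx z; exists (b, y).
pose rem k := iter k (fun z => z - \sum_(0 <= j < N) (g z).1 j *: (g z).2 j) x.
have remS k : `|rem k| <= 2^-1 ^+ k * `|x|.
  elim: k => [|k IH]; first by rewrite expr0 mul1r.
  have [_ _ h] := gP (rem k).
  by rewrite (le_trans h)// mulrC exprS -mulrA ler_pM2l// invr_gt0.
pose a i := (g (rem (i %/ N)%N)).1 (i %% N)%N.
pose y i := (g (rem (i %/ N)%N)).2 (i %% N)%N.
have blockE k j : (j <= N)%N -> \sum_(k * N <= i < k * N + j) a i *: y i =
    \sum_(0 <= i < j) (g (rem k)).1 i *: (g (rem k)).2 i.
  move=> jN; rewrite -{1}[(k * N)%N]add0n big_addn addKn.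
  apply: eq_big_nat => i /andP[_ ij]; have iN := leq_trans ij jN.
  by rewrite /a /y addnC divnMDl// modnMDl divn_small// addn0 modn_small.
have partialE k : \sum_(0 <= i < k * N) a i *: y i = x - rem k.
  elim: k => [|k IH]; first by rewrite mul0n big_geq// subrr.
  rewrite (big_cat_nat (n := k * N))//=; last by rewrite leq_mul2r leqnSn orbT.
  by rewrite IH mulSn addnC blockE// opprB [RHS]addrCA [RHS]addrC.
(* Replacing N (i / N) by i in the exponent of [q] costs a factor q^(i mod N) >= q^N = 1/2. Hence
   the 2 in [2 * K]. *)
have qdiv i : 2^-1 ^+ (i %/ N)%N <= 2 * q ^+ i.
  rewrite -qN -exprM {2}(divn_eq i N) exprD mulrCA [(N * _)%N]mulnC ler_peMr ?exprn_ge0 ?(ltW q0)//.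
  have : q ^+ N <= q ^+ (i %% N).
    by apply: ler_wiXn2l; rewrite ?(ltW q0) ?(ltW q1)// ltnW// ltn_pmod.
  by rewrite qN; lra.
exists a, y; split.
- by move=> i; have [h _ _] := gP (rem (i %/ N)%N); exact: h.
- apply/cvgrPdist_le => e e0.
  (* A partial sum may stop inside a block: its error is at most the remainder before the block plus
     fewer than [N] terms, each at most [K] times that remainder. *)
  pose M := (1 + N%:R * K) * (2 * `|x|).
  have NK0 : 0 <= 1 + N%:R * K by apply: addr_ge0 => //; exact: mulr_ge0.
  have M0 : 0 <= M by rewrite /M !mulr_ge0.
  have : M * q ^+ n @[n --> \oo] --> M * 0.
    by apply: cvgMr; apply: cvg_expr; rewrite ger0_norm// ltW.
  rewrite mulr0 => /cvgrPdist_le/(_ e e0); apply: filterS => n.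
  rewrite sub0r normrN ger0_norm ?mulr_ge0 ?exprn_ge0 ?(ltW q0)//; apply: le_trans.
  rewrite /series/= [X in index_iota 0 X](divn_eq n N).
  rewrite (big_cat_nat (n := (n %/ N) * N))//= ?leq_addr// partialE.
  rewrite blockE; last by rewrite ltnW// ltn_pmod.
  rewrite opprD opprB addrA [x + _]addrC subrK.
  set k := (n %/ N)%N; have [_ h _] := gP (rem k).
  apply: (@le_trans _ _ ((1 + N%:R * K) * `|rem k|)); last first.
    rewrite /M -mulrA ler_wpM2l//.
    by rewrite (le_trans (remS k))// mulrAC ler_wpM2r// qdiv.
  rewrite (le_trans (ler_normB _ _))// mulrDl mul1r lerD2l.
  apply: (@le_trans _ _ (\sum_(0 <= j < n %% N) K * `|rem k|)).
    by rewrite (le_trans (ler_norm_sum _ _ _))// ler_sum.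
  rewrite sumr_const_nat subn0 -mulrA mulr_natl; apply: ler_wpMn2l; first exact: mulr_ge0.
  by rewrite ltnW// ltn_pmod.
- move=> i; have [_ h _] := gP (rem (i %/ N)%N).
  rewrite (le_trans (h _))// [2 * K]mulrC -!mulrA ler_wpM2l//.
  by rewrite (le_trans (remS _))// mulrA ler_wpM2r// qdiv.
Qed.

(** Rescale [x] to norm 1, absorb the sign of vectors in -D into the coefficients, and pad the list
    to length [N] with zero coefficients. *)
Lemma half_approximation_of_unit (N : nat) (c : R) :
  0 <= c -> normalized D -> D !=set0 -> (0 < N)%N ->
  (forall x : X, `|x| <= 1 ->
    exists s : seq X, [/\ {in s, forall z, D z \/ D (- z)}, (size s <= N)%N
      & `|x - (c / N%:R) *: \sum_(z <- s) z| <= 2^-1]) ->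
  forall x : X, exists (b : nat -> R) (y : nat -> X),
    [/\ forall j, D (y j), forall j, `|b j *: y j| <= c * `|x|
      & `|x - \sum_(0 <= j < N) b j *: y j| <= `|x| / 2].
Proof.
move=> c0 D1 [y0 Dy0] N0 approx x.
have [->|x0] := eqVneq x 0.
  exists (fun=> 0), (fun=> y0); split => // [j|]; rewrite ?scale0r normr0 ?mulr0//.
  by rewrite big1 => [|j _]; rewrite ?scale0r// subr0 normr0 mul0r.
have nx : 0 < `|x| by rewrite normr_gt0.
have [|s [sD sN hs]] := approx (`|x|^-1 *: x).
  by rewrite normrZ normfV normr_id mulVf// gt_eqF.
pose t := `|x| * (c / N%:R).
have t0 : 0 <= t by rewrite mulr_ge0 ?divr_ge0.
have tc : t <= c * `|x|.
  by rewrite /t mulrC ler_wpM2r// ler_pdivrMr ?ltr0n// ler_peMr// ler1n.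
(* Past the end of [s], the default 0 is written as 0 times [y0], so that every vector used lies in
   [D]. *)
have /choice[by_ byP] : forall j, exists u : R * X,
    [/\ D u.2, `|u.1| <= c * `|x| & u.1 *: u.2 = t *: nth 0 s j].
  move=> j; have [js|js] := ltnP j (size s); last first.
    exists (0, y0); rewrite nth_default//= normr0 scale0r scaler0.
    by split => //; rewrite mulr_ge0.
  have [zD|zD] := sD _ (mem_nth 0 js).
    by exists (t, nth 0 s j); rewrite /= ger0_norm.
  by exists (- t, - nth 0 s j); rewrite /= normrN ger0_norm// scaleNr scalerN opprK.
exists (fun j => (by_ j).1), (fun j => (by_ j).2); split => [j|j|].
- by have [] := byP j.
- by have [h1 h2 _] := byP j; rewrite normrZ (D1 _ h1) mulr1.
have -> : \sum_(0 <= j < N) (by_ j).1 *: (by_ j).2 = t *: \sum_(z <- s) z.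
  rewrite (eq_bigr (fun j => t *: nth 0 s j)); last by move=> j _; have [] := byP j.
  rewrite -scaler_sumr; congr (_ *: _).
  rewrite [RHS](big_nth 0) (@big_cat_nat _ _ _ (size s))//=.
  rewrite [X in _ + X]big1_seq ?addr0// => j /andP[_].
  by rewrite mem_index_iota => /andP[sj _]; rewrite nth_default.
have -> : x - t *: \sum_(z <- s) z =
    `|x| *: (`|x|^-1 *: x - (c / N%:R) *: \sum_(z <- s) z).
  by rewrite scalerBr !scalerA mulfV ?gt_eqF// scale1r.
by rewrite normrZ normr_id ler_wpM2l.
Qed.
End iteration.

(** * The converse, and the choice of constants *)

Lemma quick_abs_representing_system {R : realType} {X : completeNormedModType R}
    (D : set X) (c q : R) : 0 < c -> 0 < q < 1 ->
  quick_representing_system c q D -> abs_representing_system (c / (1 - q)) D.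
Proof.
move=> c0 /andP[q0 q1] qD x x1.
have [a [y [Dy ax aq]]] := qD x; exists a, y; split => //.
apply: lime_le; first by apply: is_cvg_nneseries => i _ _; rewrite lee_fin.
apply: nearW => n; rewrite sumEFin lee_fin.
apply: (@le_trans _ _ (series (geometric c q) n)).
  apply: ler_sum => i _; rewrite (le_trans (aq i))//= ler_piMr//.
  by rewrite mulr_ge0 ?exprn_ge0 ?ltW.
rewrite geometric_seriesE ?lt_eqF// ler_wpM2r ?invr_ge0 ?subr_ge0 ?(ltW q1)//.
by rewrite ler_piMr ?(ltW c0)// gerBl exprn_ge0// ltW.
Qed.

Theorem corollary4p2 (R : realType) :
  (forall c p T : R, 1 < c -> 1 < p ->
     exists c1 q : R, [/\ 0 < c1, 0 < q < 1
       & forall X : completeNormedModType R, (exists x : X, x != 0) ->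
         of_type p X -> is_type_constant p X T ->
         forall D : set X, normalized D ->
           abs_representing_system c D -> quick_representing_system c1 q D])
  /\
  (forall c1 q : R, 0 < c1 -> 0 < q < 1 ->
     exists c : R,
       forall (p : R) (X : completeNormedModType R), (exists x : X, x != 0) ->
         1 < p -> of_type p X ->
         forall D : set X, normalized D ->
           quick_representing_system c1 q D -> abs_representing_system c D).
Proof.
split=> [c p T c1 p1|c1 q c10 q01]; last first.
  by exists (c1 / (1 - q)) => p X _ _ _ D _; exact: quick_abs_representing_system.
have c0 : 0 < c by exact: lt_trans c1.
have rho2 : 0 < 2 - 2 `^ p^-1 by rewrite subr_gt0 root2_lt2.
(* The constants are chosen before the space, when [T] is still an arbitrary real; the maximum keeps
   [K] nonnegative and equals [T] once [T] is a type constant. *)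
pose K := 4 * (c * Num.max T 0 * 2 `^ p^-1 / (2 - 2 `^ p^-1)).
have K0 : 0 <= K.
  by rewrite !mulr_ge0 ?invr_ge0 ?powR_ge0 ?(ltW rho2) ?(ltW c0)// le_max lexx orbT.
have [N [N0 hN]] := exists_natr_powR_le p K p1 K0.
pose q : R := 2^-1 `^ N%:R^-1.
have qN : q ^+ N = 2^-1.
  by rewrite -powR_mulrn ?powR_ge0// -powRrM mulVf ?pnatr_eq0 -?lt0n// powRr1// invr_ge0.
have q0 : 0 < q by rewrite powR_gt0// invr_gt0.
have q1 : q < 1.
  rewrite ltNge; apply/negP => /(exprn_ege1 N); rewrite qN; lra.
exists (2 * c), q; split; rewrite ?mulr_gt0 ?q0//.
move=> X [x0 _] _ [T0 XT _] D D1 Dc.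
apply: (quick_of_half_approximation _ N); rewrite ?q0 ?(ltW c0)//.
(* Even the representation of 0 uses elements of [D]. *)
have D0 : D !=set0.
  by have [|a [y [Dy _ _]]] := Dc 0; [rewrite normr0|exists (y 0%N)].
apply: half_approximation_of_unit; rewrite ?(ltW c0)//.
apply: (ars_approximation _ _ p T) => //.
by move: hN; rewrite /K max_l// ltW.
Qed.
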